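(* (1) For each element $a\in\mathbb{I}_1\setminus F$ with $n:=\dim_K(\mathrm{coker}(a_{K[x]}))$, there exists an element $\partial^n+f$ for some $f\in F$ (resp. $s\in(1+F)^*$) such that the map $((\partial^n+f)a)_{K[x]}$ (resp. $(s\partial^ns^{-1}a)_{K[x]}$) is a surjection. In this case, $\ker(((\partial^n+f)a)_{K[x]})=\ker(a_{K[x]})$ (resp. $\ker((s\partial^ns^{-1}a)_{K[x]})=\ker(a_{K[x]})$). (2) For each element $a\in\mathbb{I}_1\setminus F$ with $n:=\dim_K(\ker(a_{K[x]}))$, there exists an element $\int^n+g$ for some $g\in F$ (resp. $s\in(1+F)^*$) such that the map $(a(\int^n+g))_{K[x]}$ (resp. $(as\int^ns^{-1})_{K[x]}$) is an injection. In this case, $\mathrm{im}((a(\int^n+g))_{K[x]})=\mathrm{im}(a_{K[x]})$ (resp. $\mathrm{im}((as\int^ns^{-1})_{K[x]})=\mathrm{im}(a_{K[x]})$). (3) For each element $a\in\mathbb{I}_1\setminus F$ with $m:=\dim_K(\ker(a_{K[x]}))$ and $n:=\dim_K(\mathrm{coker}(a_{K[x]}))$, there exist elements $\partial^n+f$ and $\int^m+g$ for some $f,g\in F$ (resp. $s,t\in(1+F)^*$) such that the map $((\partial^n+f)a(\int^m+g))_{K[x]}$ (resp. $(s\partial^ns^{-1}at\int^mt^{-1})_{K[x]}$) is a bijection.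
   Context: $K$ is a field of characteristic zero. $\mathbb{I}_1$ is the subalgebra of $\mathrm{End}_K(K[x])$ generated by (multiplication by) $x$, $\partial=\frac{d}{dx}$ and $\int: x^n\mapsto \frac{x^{n+1}}{n+1}$. Put $e_{ij}:=\int^i\partial^j-\int^{i+1}\partial^{j+1}$ ($i,j\ge0$) and $F:=\bigoplus_{i,j\ge0}Ke_{ij}$, an ideal of $\mathbb{I}_1$; $(1+F)^*$ is the group of units of the multiplicative monoid $1+F$. For $b\in\mathbb{I}_1$, $b_{K[x]}:K[x]\to K[x]$, $p\mapsto bp$. For $a\in\mathbb{I}_1\setminus F$ the kernel and cokernel of $a_{K[x]}$ are finite dimensional. *)

(* Defs.v *)
From HB Require Import structures.
From mathcomp Require Export all_boot all_order all_algebra.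
From mathcomp Require Export boolp classical_sets functions.
Set Implicit Arguments.
Unset Strict Implicit.
Unset Printing Implicit Defensive.
Import GRing.Theory.
Local Open Scope classical_set_scope.
Local Open Scope ring_scope.

(* End_K(K[x]), a K-algebra under composition: (a * b) p = a (b p). *)
Definition endo (K : fieldType) := {linear {poly K} -> {poly K}}.

Section EndoAlgebra.
Variable K : fieldType.
Local Notation E := (endo K).
Implicit Types (a b c : E) (k : K).

HB.instance Definition _ := gen_eqMixin E.
HB.instance Definition _ := gen_choiceMixin E.

Lemma endoP a b : a =1 b -> a = b.
Proof.
case: a b => [f [[fZ] [fA]]] [g [[gZ] [gA]]] /= fg.
have efg : f = g by apply/funext.
case: _ / efg in gZ gA fg *.
by rewrite (Prop_irrelevance fZ gZ) (Prop_irrelevance fA gA).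
Qed.

Definition endo0 : E := \0.
Definition endo_opp a : E := \- a.
Definition endo_add a b : E := a \+ b.
Definition endo1 : E := idfun.
Definition endo_mul a b : E := a \o b.
Definition endo_scale k a : E := k \*: a.

Fact endo_addA : associative endo_add.
Proof. by move=> a b c; apply: endoP => p /=; rewrite addrA. Qed.
Fact endo_addC : commutative endo_add.
Proof. by move=> a b; apply: endoP => p /=; rewrite addrC. Qed.
Fact endo_add0 : left_id endo0 endo_add.
Proof. by move=> a; apply: endoP => p /=; rewrite add0r. Qed.
Fact endo_addN : left_inverse endo0 endo_opp endo_add.
Proof. by move=> a; apply: endoP => p /=; rewrite addNr. Qed.
HB.instance Definition _ :=
  GRing.isZmodule.Build E endo_addA endo_addC endo_add0 endo_addN.

Fact endo_mulA : associative endo_mul.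
Proof. by move=> a b c; apply: endoP. Qed.
Fact endo_mul1l : left_id endo1 endo_mul.
Proof. by move=> a; apply: endoP. Qed.
Fact endo_mul1r : right_id endo1 endo_mul.
Proof. by move=> a; apply: endoP. Qed.
Fact endo_mulDl : left_distributive endo_mul +%R.
Proof. by move=> a b c; apply: endoP. Qed.
Fact endo_mulDr : right_distributive endo_mul +%R.
Proof. by move=> a b c; apply: endoP => p /=; rewrite raddfD. Qed.
Fact endo_1neq0 : endo1 != 0.
Proof.
by apply/eqP => /(congr1 (fun a : E => a 1)) /= /eqP; rewrite oner_eq0.
Qed.
HB.instance Definition _ := GRing.Zmodule_isNzRing.Build E
  endo_mulA endo_mul1l endo_mul1r endo_mulDl endo_mulDr endo_1neq0.

Fact endo_scaleA k l a : endo_scale k (endo_scale l a) = endo_scale (k * l) a.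
Proof. by apply: endoP => p /=; rewrite scalerA. Qed.
Fact endo_scale1 : left_id 1 endo_scale.
Proof. by move=> a; apply: endoP => p /=; rewrite scale1r. Qed.
Fact endo_scaleDr : right_distributive endo_scale +%R.
Proof. by move=> k a b; apply: endoP => p /=; rewrite scalerDr. Qed.
Fact endo_scaleDl a : {morph endo_scale^~ a : k l / k + l}.
Proof. by move=> k l; apply: endoP => p /=; rewrite scalerDl. Qed.
HB.instance Definition _ := GRing.Zmodule_isLmodule.Build K E
  endo_scaleA endo_scale1 endo_scaleDr endo_scaleDl.

Fact endo_scaleAl k a b : k *: (a * b) = (k *: a) * b.
Proof. by apply: endoP. Qed.
HB.instance Definition _ := GRing.Lmodule_isLalgebra.Build K E endo_scaleAl.

Fact endo_scaleAr k a b : k *: (a * b) = a * (k *: b).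
Proof. by apply: endoP => p; rewrite /= /endo_scale /= linearZ. Qed.
HB.instance Definition _ := GRing.Lalgebra_isAlgebra.Build K E endo_scaleAr.

(* a^-1 is the two-sided inverse of a when there is one, and a otherwise. *)
Definition endo_inverse a : set E := [set b | b * a = 1 /\ a * b = 1].
Definition endo_unit : pred E := fun a => `[< exists b, endo_inverse a b >].
Definition endo_inv a : E := xget a (endo_inverse a).

Fact endo_mulV : {in endo_unit, left_inverse 1 endo_inv *%R}.
Proof. by move=> a /asboolP /(xgetPex a) []. Qed.
Fact endo_divV : {in endo_unit, right_inverse 1 endo_inv *%R}.
Proof. by move=> a /asboolP /(xgetPex a) []. Qed.
Fact endo_unitP a b : b * a = 1 /\ a * b = 1 -> endo_unit a.
Proof. by move=> ab; apply/asboolP; exists b. Qed.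
Fact endo_inv_out : {in [predC endo_unit], endo_inv =1 id}.
Proof.
move=> a /negP na; rewrite /endo_inv; case: xgetP => // b _ ab.
by case: na; apply/asboolP; exists b.
Qed.
HB.instance Definition _ := GRing.NzRing_hasMulInverse.Build E
  endo_mulV endo_divV endo_unitP endo_inv_out.

Lemma endo_mulE a b p : (a * b) p = a (b p). Proof. by []. Qed.
Lemma endo_addE a b p : (a + b) p = a p + b p. Proof. by []. Qed.
Lemma endo_scaleE k a p : (k *: a) p = k *: a p. Proof. by []. Qed.
Lemma endo1E p : (1 : E) p = p. Proof. by []. Qed.

End EndoAlgebra.

Section Generators.
Variable K : fieldType.
Implicit Types p : {poly K}.

Definition mulX p : {poly K} := 'X * p.

Definition integral p : {poly K} :=
  \sum_(i < size p) (p`_i / i.+1%:R) *: 'X^(i.+1).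

Fact mulX_linear : linear mulX.
Proof. by move=> k p q; rewrite /mulX mulrDr scalerAr. Qed.
HB.instance Definition _ :=
  GRing.isLinear.Build K {poly K} {poly K} *:%R mulX mulX_linear.

Lemma integral_widen n p : (size p <= n)%N ->
  integral p = \sum_(i < n) (p`_i / i.+1%:R) *: 'X^(i.+1).
Proof.
move=> le_pn; rewrite /integral.
rewrite (big_ord_widen n (fun i => (p`_i / i.+1%:R) *: 'X^(i.+1)) le_pn).
rewrite big_mkcond; apply: eq_bigr => i _; case: ltnP => // le_pi.
by rewrite nth_default // mul0r scale0r.
Qed.

Fact integral_linear : linear integral.
Proof.
move=> k p q; set n := maxn (size p) (size q).
have le_pn : (size p <= n)%N by apply: leq_maxl.
have le_qn : (size q <= n)%N by apply: leq_maxr.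
have le_n : (size (k *: p + q)%R <= n)%N.
  apply: leq_trans (size_polyD _ _) _; rewrite geq_max le_qn andbT.
  exact: leq_trans (size_scale_leq _ _) le_pn.
rewrite !(@integral_widen n) // scaler_sumr -big_split; apply: eq_bigr => i _.
by rewrite /= coefD coefZ scalerA -scalerDl mulrDl mulrA.
Qed.
HB.instance Definition _ :=
  GRing.isLinear.Build K {poly K} {poly K} *:%R integral integral_linear.

Lemma integralXn n : integral 'X^n = n.+1%:R^-1 *: 'X^(n.+1).
Proof.
rewrite /integral size_polyXn big_ord_recr /= coefXn eqxx mul1r big1 ?add0r //.
by move=> i _; rewrite coefXn (ltn_eqF (ltn_ord i)) mul0r scale0r.
Qed.

End Generators.

Definition X_ (K : fieldType) : endo K := @mulX K.
Definition D_ (K : fieldType) : endo K := @deriv K.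
Definition I_ (K : fieldType) : endo K := @integral K.

Arguments X_ {K}.
Arguments D_ {K}.
Arguments I_ {K}.

(* The algebra of polynomial integro-differential operators, as the smallest
   K-subalgebra (with 1) of End_K(K[x]) containing the three generators. *)
Definition I1 (K : fieldType) : set (endo K) :=
  [set a | forall S : {pred endo K}, subalg_closed S ->
     X_ \in S -> D_ \in S -> I_ \in S -> a \in S].
Arguments I1 : clear implicits.

Definition e_ (K : fieldType) (i j : nat) : endo K :=
  I_ ^+ i * D_ ^+ j - I_ ^+ i.+1 * D_ ^+ j.+1.

Definition F (K : fieldType) : set (endo K) :=
  [set f | exists (n : nat) (c : 'M[K]_n),
     f = \sum_(i < n) \sum_(j < n) c i j *: e_ K i j].
Arguments F : clear implicits.

Definition oneF (K : fieldType) : set (endo K) :=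
  [set s | exists2 f, F K f & s = 1 + f].
Arguments oneF : clear implicits.

(* The inverse is required to lie in 1 + F as well. *)
Definition oneF_units (K : fieldType) : set (endo K) :=
  [set s | oneF K s /\ exists t, [/\ oneF K t, s * t = 1 & t * s = 1]].
Arguments oneF_units : clear implicits.

(* For subspaces W <= V: the classes of b_0, ..., b_(n-1) form a basis of the
   quotient V / W. *)
Definition quotient_basis (K : fieldType) (E : lmodType K) (V W : set E)
    (n : nat) (b : 'I_n -> E) : Prop :=
  [/\ forall i, V (b i),
      forall v, V v -> exists c : 'I_n -> K, W (v - \sum_i c i *: b i)
    & forall c : 'I_n -> K, W (\sum_i c i *: b i) -> forall i, c i = 0].

(* dim_K (V / W), with value 0 when it is infinite. *)
Definition quotient_dim (K : fieldType) (E : lmodType K) (V W : set E) : nat :=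
  xget 0%N [set n | exists b : 'I_n -> E, quotient_basis V W b].

Definition kernel (K : fieldType) (a : endo K) : set {poly K} :=
  [set p | a p = 0].

Definition dim_ker (K : fieldType) (a : endo K) : nat :=
  quotient_dim (kernel a) [set 0].

Definition dim_coker (K : fieldType) (a : endo K) : nat :=
  quotient_dim [set: {poly K}] (range a).

Definition surjection (K : fieldType) (a : endo K) : Prop :=
  set_surj [set: {poly K}] [set: {poly K}] a.

(* Main.v *)
From HB Require Import structures.
Require Import Defs.
From mathcomp Require Import zify.
Set Implicit Arguments.
Unset Strict Implicit.
Unset Printing Implicit Defensive.
Import GRing.Theory.
Local Open Scope classical_set_scope.
Local Open Scope ring_scope.

(** Call an operator a of K[x] eventually degree-shifting when, above some
    degree, it shifts the degree of every polynomial by one fixed amount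
    (the predicate [size_shift], stated with sizes). The whole argument rests
    on the fact that every element of I_1 outside F has this property
    ([I1_size_shift]), which reduces its kernel and cokernel to those of a finite
    matrix. Below, D stands for d/dx and I for integration.

    To see this, use the Euler operator H = x d/dx, for which
    c(H) x^n = c(n) x^n. Since I c(H) = c(H - 1) I, the sums of c_k(H) I^k
    form an algebra of operators, and each a in I_1 satisfies
    a I^N = sum_k c_k(H) I^k for N large, because D is a left inverse of I.
    If all c_k vanish then a I^N = 0, which says exactly that a is in F
    ([F_annihil]). Otherwise the term of top k wins: in characteristic zero
    c_k(n) vanishes for finitely many n only, so a I^N, and then a itself,
    shifts large degrees uniformly.

    When a shifts sizes above N to sizes above M, it maps polynomials of size
    at most N to polynomials of size at most M by an N x M matrix A, and it is
    bijective between the corresponding quotients. Hence the kernel and the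
    cokernel of a are those of A, of dimensions N - rank A and M - rank A
    ([dim_kerE], [dim_cokerE]).

    Existence. Let n be the dimension of the cokernel. It suffices that s
    maps the polynomials of size at most n, which form the kernel of D^n, onto
    a complement of the image of a: then D^n s^-1 a is onto. Gaussian
    elimination gives an invertible matrix whose first n rows span such a
    complement, and s is that matrix extended by the identity
    ([unit_spanning]). Dually, with n the dimension of the kernel, a s I^n s^-1
    is injective as soon as s maps the polynomials of size at most n onto the
    kernel of a. Since s and s^-1 are 1 modulo F, s D^n s^-1 - D^n and
    s I^n s^-1 - I^n lie in F, so these operators also have the forms D^n + f
    and I^n + g.

    Equality of kernels or images. The operators D^n + f and I^n + g shift
    sizes as D^n and I^n do, so the three operators involved are given by
    matrices A, B and their product. Surjectivity (injectivity) says that the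
    product has as many columns (rows) as its rank, and by the choice of n that
    number is rank A. So the product and A have the same rank, hence the same
    kernel (image).

    The bijection is formal: if b a is onto with the kernel of a, and a c
    is injective with the image of a, then b a c is bijective
    ([bijective_conj]). *)

(** * Operators that shift large degrees uniformly *)

(** Sizes are used instead of degrees in order that the zero polynomial and
    negative shifts M - N need no separate treatment. *)
Definition size_shift (K : fieldType) (N M : nat) (a : endo K) : Prop :=
  forall p : {poly K},
    if (size p <= N)%N then (size (a p) <= M)%N
    else (size (a p) + N == size p + M)%N.

Section SizeShift.
Variable K : fieldType.
Implicit Types (a b : endo K) (p : {poly K}).

Lemma endo_subE a b p : (a - b) p = a p - b p. Proof. by []. Qed.

Lemma endo_sumE I (r : seq I) (P : pred I) (a : I -> endo K) p :
  (\sum_(i <- r | P i) a i) p = \sum_(i <- r | P i) a i p.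
Proof. exact: (big_morph (fun c : endo K => c p)). Qed.

Lemma size_shift_le N M a p : size_shift N M a ->
  (size p <= N)%N -> (size (a p) <= M)%N.
Proof. by move=> sa pN; have := sa p; rewrite pN. Qed.

Lemma size_shift_gt N M a p : size_shift N M a ->
  (N < size p)%N -> (size (a p) + N = size p + M)%N.
Proof. by move=> sa pN; have := sa p; rewrite leqNgt pN => /eqP. Qed.

Lemma size_shift_mono N M a p : size_shift N M a ->
  (size (a p) <= M)%N -> (size p <= N)%N.
Proof.
move=> sa; apply: contraLR; rewrite -!ltnNge => pN.
by have := size_shift_gt sa pN; lia.
Qed.

Lemma size_shift_add N M a L : size_shift N M a -> size_shift (N + L) (M + L) a.
Proof.
move=> sa p; have := sa p.
by case: (leqP (size p) N) => ?; case: (leqP (size p) (N + L)) => ?; lia.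
Qed.

Lemma size_shiftM N M P a b :
  size_shift N M a -> size_shift M P b -> size_shift N P (b * a).
Proof.
move=> sa sb p; rewrite endo_mulE; have := sb (a p); have := sa p.
by case: (leqP (size p) N) => ?; case: (leqP (size (a p)) M) => ?; lia.
Qed.

(** A perturbation is harmless when it cannot reach the top degree: either it is
    bounded, or it raises no degree while a raises all large ones. *)
Lemma size_shiftD N M a b : size_shift N M a ->
    (forall p : {poly K}, (size (b p) <= M)%N) \/
    (forall p : {poly K}, (size (b p) <= size p)%N /\ (N < M)%N) ->
  size_shift N M (a + b).
Proof.
move=> sa sb p; rewrite endo_addE.
have ab : (if size p <= N then size (b p) <= M else size (b p) < size (a p))%N.
  have := sa p.
  by case: (leqP (size p) N) => ?; case: sb => /(_ p) => [?|[? ?]]; lia.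
have := sa p; case: (leqP (size p) N) ab => pN ab ap;
  last by rewrite size_polyDl.
by rewrite (leq_trans (size_polyD _ _)) // geq_max ap.
Qed.

Lemma poly_sum_monomials n p : (size p <= n)%N ->
  p = \sum_(i < n) p`_i *: 'X^i.
Proof.
move=> pn; rewrite -poly_def; apply/polyP => i; rewrite coef_poly.
by case: ltnP => // ni; rewrite nth_default // (leq_trans pn).
Qed.

Lemma bounded_size a N :
  exists M, forall p : {poly K}, (size p <= N)%N -> (size (a p) <= M)%N.
Proof.
exists (\max_(i < N) size (a 'X^i)) => p pN.
rewrite (poly_sum_monomials pN) linear_sum; apply: leq_trans (size_sum _ _ _) _.
apply/bigmax_leqP => i _.
rewrite linearZZ; apply: leq_trans (size_scale_leq _ _) _.
exact: (leq_bigmax (F := fun j : 'I_N => size (a 'X^j))).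
Qed.

End SizeShift.

(** * The ideal F *)

Section Calculus.
Variables (K : fieldType) (charK0 : [pchar K] =i pred0).
Local Notation I := (I_ : endo K).
Local Notation D := (D_ : endo K).
Implicit Types (a b g : endo K) (p : {poly K}).

Lemma natr_eq0_pchar0 n : (n%:R == 0 :> K) = (n == 0%N).
Proof. exact: (pcharf0P K).1 charK0 n. Qed.

Lemma natr_inj_pchar0 : injective (fun n => n%:R : K).
Proof.
move=> m n; wlog mn : m n / (m <= n)%N => [IH|].
  by case: (leqP m n) => [|/ltnW] /IH // IH' /esym /IH' ->.
move=> /= mnK; apply/eqP; rewrite eqn_leq mn -subn_eq0 -natr_eq0_pchar0.
by rewrite natrB // mnK subrr eqxx.
Qed.

Lemma coef_integral p i : (I p)`_i = if i is k.+1 then p`_k / k.+1%:R else 0.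
Proof.
have -> : I p = 'X * \poly_(k < size p) (p`_k / k.+1%:R).
  rewrite poly_def mulr_sumr; apply: eq_bigr => k _.
  by rewrite -scalerAr -exprS.
rewrite coefXM; case: i => //= k; rewrite coef_poly; case: ltnP => // pk.
by rewrite nth_default // mul0r.
Qed.

Lemma coef_derivation p i : (D p)`_i = p`_i.+1 *+ i.+1.
Proof. exact: coef_deriv. Qed.

Lemma D_mulI : D * I = 1.
Proof.
apply: endoP => p; apply/polyP => i.
rewrite endo_mulE coef_derivation coef_integral /= -[LHS]mulr_natr divfK //.
by rewrite natr_eq0_pchar0.
Qed.

Lemma Dn_mulIn n : D ^+ n * I ^+ n = 1.
Proof.
elim: n => [|n IHn]; first by rewrite mulr1.
by rewrite exprSr exprS mulrA -(mulrA (D ^+ n)) D_mulI mulr1.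
Qed.

Lemma size_shift_D : size_shift 1 0 D.
Proof.
move=> p; case: leqP => p1.
  rewrite leqn0 size_poly_eq0; apply/eqP/polyP => i.
  by rewrite coef_derivation nth_default ?mul0rn ?coef0 // (leq_trans p1).
have p0 : p != 0 by rewrite -size_poly_gt0 (leq_trans _ p1).
have : (size (D p) < size p)%N by apply: lt_size_deriv.
suff : ((size p).-2 < size (D p))%N by lia.
rewrite ltnNge; apply/negP => /(nth_default 0); rewrite coef_derivation.
have -> : (size p).-2.+1 = (size p).-1 by lia.
move/eqP; rewrite -mulr_natr mulf_eq0 natr_eq0_pchar0 -lead_coefE lead_coef_eq0.
by rewrite (negPf p0) /=; case: (size p) p1 => [|[]].
Qed.

Lemma size_shift_I : size_shift 0 1 I.
Proof.
move=> p; case: leqP => p0.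
  move: p0; rewrite leqn0 size_poly_eq0 => /eqP ->.
  by rewrite linear0 size_poly0.
have DI : D (I p) = p by rewrite -endo_mulE D_mulI.
have := size_shift_D (I p); rewrite DI; case: leqP => ?; lia.
Qed.

Lemma size_shift_Dn n : size_shift n 0 (D ^+ n).
Proof.
elim: n => [|n IHn]; first by move=> p; rewrite endo1E; case: leqP; lia.
rewrite exprS; apply: (@size_shiftM _ _ 1).
  by have := size_shift_add 1 IHn; rewrite addn1.
exact: size_shift_D.
Qed.

Lemma size_shift_In n : size_shift 0 n (I ^+ n).
Proof.
elim: n => [|n IHn]; first by move=> p; rewrite endo1E; case: leqP; lia.
rewrite exprSr; apply: size_shiftM size_shift_I _.
by have := size_shift_add 1 IHn; rewrite add0n addn1.
Qed.

Lemma Dn_small n p : (size p <= n)%N -> (D ^+ n) p = 0.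
Proof.
move=> /(size_shift_le (size_shift_Dn n)).
by rewrite leqn0 size_poly_eq0 => /eqP.
Qed.

(** The remainder is killed by D^n: it is the Taylor polynomial of p at 0. *)
Lemma size_taylor n p : (size (p - (I ^+ n) ((D ^+ n) p))%R <= n)%N.
Proof.
apply: size_shift_mono (size_shift_Dn n) _.
by rewrite linearB -(endo_mulE (D ^+ n)) Dn_mulIn endo1E subrr size_poly0.
Qed.

Lemma Dn_mulI n k : (n <= k)%N -> D ^+ n * I ^+ k = I ^+ (k - n).
Proof. by move=> nk; rewrite -{1}(subnKC nk) exprD mulrA Dn_mulIn mul1r. Qed.

(** The I^i 1 are the divided powers x^i / i!. *)
Lemma scale_I1 i : i`!%:R *: (I ^+ i) 1 = 'X^i.
Proof.
elim: i => [|i IHi]; first by rewrite endo1E scale1r expr0.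
rewrite factS natrM exprS endo_mulE -scalerA.
have -> : i`!%:R *: I ((I ^+ i) 1) = I 'X^i by rewrite -linearZ IHi.
rewrite [I _](integralXn K i) scalerA mulfV ?scale1r //.
by rewrite natr_eq0_pchar0.
Qed.

(** In the basis of divided powers e_ij is a matrix unit, with value x^i / i! on
    x^j / j!; so it vanishes on the range of I^N for N > j. *)
Lemma e_annihil i j N : (j < N)%N -> e_ K i j * I ^+ N = 0.
Proof.
move=> jN; rewrite mulrBl -!mulrA (Dn_mulI (ltnW jN)) (Dn_mulI jN) -!exprD.
by rewrite (_ : i + (N - j) = i.+1 + (N - j.+1))%N ?subrr //; lia.
Qed.

Lemma annihil_le a N L : (N <= L)%N -> a * I ^+ N = 0 -> a * I ^+ L = 0.
Proof. by move=> /subnKC <- aN; rewrite exprD mulrA aN mul0r. Qed.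

Lemma annihil_bounded a N : a * I ^+ N = 0 ->
  exists M, forall p : {poly K}, (size (a p) <= M)%N.
Proof.
move=> aN; have [M aM] := bounded_size a N; exists M => p.
have -> : a p = a (p - (I ^+ N) ((D ^+ N) p)); last exact/aM/size_taylor.
by rewrite linearB -(endo_mulE a) aN subr0.
Qed.

(** The sum telescopes to the projection onto the polynomials of degree < n. *)
Lemma sum_e_diag n : \sum_(j < n) e_ K j j = 1 - I ^+ n * D ^+ n.
Proof.
elim: n => [|n IHn]; first by rewrite big_ord0 mulr1 subrr.
by rewrite big_ord_recr /= IHn addrA subrK.
Qed.

Lemma e_E i j p : e_ K i j p = (((D ^+ j) p)`_0) *: (I ^+ i) 1.
Proof.
rewrite /e_ exprSr exprS endo_subE !endo_mulE -linearB -linearZ.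
congr ((I ^+ i) _).
have := size_taylor 1 ((D ^+ j) p); rewrite !expr1 => /size1_polyC ->.
by rewrite coefB coef_integral subr0 alg_polyC.
Qed.

(** F is the ideal of finite matrices in the basis of divided powers. As each
    column of the matrix of an operator is finite, belonging to F only requires
    that the columns vanish from some index on. *)
Lemma F_annihil g : F K g <-> exists N, g * I ^+ N = 0.
Proof.
split=> [[n [c ->]]|[N gN]].
  exists n; rewrite mulr_suml big1 // => i _; rewrite mulr_suml big1 // => j _.
  by rewrite -scalerAl e_annihil ?scaler0.
have [M gM] := annihil_bounded gN; exists (maxn N M).
(* The factor i! converts coefficients on x^i into coordinates on I^i 1. The
   matrix has to be square: N bounds its nonzero columns and M its rows. *)
exists (\matrix_(i, j) ((g ((I ^+ j) 1))`_i * i`!%:R)).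
rewrite exchange_big /= -[LHS]mulr1.
have -> : (1 : endo K) =
    \sum_(j < maxn N M) e_ K j j + I ^+ maxn N M * D ^+ maxn N M.
  by rewrite sum_e_diag subrK.
rewrite mulrDr mulrA (annihil_le (leq_maxl N M) gN) mul0r addr0 mulr_sumr.
apply: eq_bigr => j _; apply: endoP => p.
rewrite endo_mulE e_E linearZZ endo_sumE.
set q := g _; have qM : (size q <= maxn N M)%N.
  exact: leq_trans (gM _) (leq_maxr N M).
rewrite {1}(poly_sum_monomials qM) scaler_sumr; apply: eq_bigr => i _.
rewrite endo_scaleE mxE e_E -scale_I1 !scalerA; congr (_ *: _).
by rewrite [RHS]mulrC mulrA.
Qed.

Lemma F_add a b : F K a -> F K b -> F K (a + b).
Proof.
move=> /F_annihil [N aN] /F_annihil [L bL]; apply/F_annihil; exists (maxn N L).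
rewrite mulrDl (annihil_le _ aN) ?(annihil_le _ bL) ?addr0 //.
  exact: leq_maxr.
exact: leq_maxl.
Qed.

Lemma F_mull a b : F K b -> F K (a * b).
Proof.
by move=> /F_annihil [N bN]; apply/F_annihil; exists N; rewrite -mulrA bN mulr0.
Qed.

(** F is stable under right multiplication only by operators that, like D and I,
    have finitely many nonzero entries in each row. *)
Lemma F_mulD a n : F K a -> F K (a * D ^+ n).
Proof.
move=> /F_annihil [N aN]; apply/F_annihil; exists (n + N)%N.
by rewrite exprD -mulrA (mulrA (D ^+ n)) Dn_mulIn mul1r.
Qed.

Lemma F_mulI a n : F K a -> F K (a * I ^+ n).
Proof.
move=> /F_annihil [N aN]; apply/F_annihil; exists N.
by rewrite -mulrA -exprD addnC exprD mulrA aN mul0r.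
Qed.

Lemma size_shift_F N M a g : size_shift N M a -> F K g ->
  exists L0, forall L, (L0 <= L)%N -> size_shift (N + L) (M + L) (a + g).
Proof.
move=> sa /F_annihil [_ /annihil_bounded [L0 gL0]]; exists L0 => L L0L.
apply: size_shiftD; first exact: size_shift_add.
by left=> p; apply: leq_trans (gL0 p) _; rewrite (leq_trans L0L) ?leq_addl.
Qed.

End Calculus.

(** * Operators in I_1 outside F shift large degrees uniformly *)

Section Fredholm.
Variables (K : fieldType) (charK0 : [pchar K] =i pred0).
Local Notation I := (I_ : endo K).
Local Notation D := (D_ : endo K).
Local Notation H := (X_ * D_ : endo K).
Implicit Types (a b g : endo K) (p c : {poly K}) (C : {poly {poly K}}).

(** The Euler operator is diagonal in the basis of monomials. *)
Lemma coef_eulerE c p i : (horner_alg H c p)`_i = c.[i%:R] * p`_i.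
Proof.
elim/poly_ind: c p => [|c k IHc] p.
  by rewrite rmorph0 horner0 mul0r coef0.
have -> : horner_alg H (c * 'X + k%:P) = horner_alg H c * H + k%:A.
  by rewrite rmorphD rmorphM /= horner_algX horner_algC.
rewrite endo_addE coefD hornerMXaddC.
rewrite endo_mulE IHc mulrDl -mulrA.
congr (_ * _ + _); last by rewrite endo_scaleE endo1E coefZ.
rewrite endo_mulE [X_ _]/= /mulX coefXM.
case: i IHc => [|i] _ /=; first by rewrite mul0r.
by rewrite coef_derivation mulr_natl.
Qed.

Lemma nat_roots_bounded c : c != 0 ->
  exists n0, forall n, (n0 <= n)%N -> c.[n%:R] != 0.
Proof.
have [k] := ubnP (size c); elim: k c => // k IHk c ck c0.
have [[i ci]|noroot] := pselect (exists i : nat, root c i%:R); last first.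
  by exists 0%N => n _; apply/negP => cn; case: noroot; exists n.
have [d cE] := factor_theorem c i%:R ci.
have d0 : d != 0 by apply: contraNneq c0 => d0; rewrite cE d0 mul0r.
have [|n0 dn] := IHk d _ d0.
  by move: ck; rewrite cE size_Mmonic ?monicXsubC // size_XsubC addn2.
exists (maxn n0 i.+1) => n; rewrite geq_max => /andP[n0n ni].
rewrite cE hornerM mulf_neq0 ?dn // hornerXsubC subr_eq0.
by apply: contraTneq ni => /(natr_inj_pchar0 charK0) ->; rewrite ltnn.
Qed.

Lemma size_euler_le c p : (size (horner_alg H c p) <= size p)%N.
Proof.
by apply/leq_sizeP => i pi; rewrite coef_eulerE nth_default ?mulr0.
Qed.

(** Past the natural roots of c, the diagonal entries of c(H) are nonzero. *)
Lemma size_shift_euler c : c != 0 ->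
  exists n0, forall n, (n0 <= n)%N -> size_shift n n (horner_alg H c).
Proof.
move=> /nat_roots_bounded [n0 cn0]; exists n0 => n n0n p.
have cp := size_euler_le c p; case: leqP => pn; first exact: leq_trans cp pn.
rewrite eqn_add2r eqn_leq cp /= -(@prednK (size p)) ?(leq_trans _ pn) //.
rewrite ltnNge; apply/negP => /(nth_default 0)/eqP.
rewrite coef_eulerE mulf_eq0 -lead_coefE lead_coef_eq0 -size_poly_eq0.
have n0p : (n0 <= (size p).-1)%N by lia.
by rewrite (negPf (cn0 _ n0p)) /= => /eqP p0; rewrite p0 in pn.
Qed.

(** The sum of the c_k(H) I^k, for C with coefficients c_k. Horner evaluation in
    a noncommutative ring keeps coefficients on the left, which makes this
    operator additive in C although it is not multiplicative. *)
Definition symbol_op C : endo K := (map_poly (horner_alg H) C).[I].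

Lemma symbol_opC c : symbol_op c%:P = horner_alg H c.
Proof. by rewrite /symbol_op map_polyC hornerC. Qed.

Lemma symbol_opMXaddC C c :
  symbol_op (C * 'X + c%:P) = symbol_op C * I + horner_alg H c.
Proof.
by rewrite /symbol_op rmorphD rmorphM /= map_polyX map_polyC hornerMXaddC.
Qed.

Lemma symbol_opD C1 C2 : symbol_op (C1 + C2) = symbol_op C1 + symbol_op C2.
Proof. by rewrite /symbol_op rmorphD hornerD. Qed.

Lemma symbol_opCM c C : symbol_op (c%:P * C) = horner_alg H c * symbol_op C.
Proof. by rewrite /symbol_op rmorphM /= map_polyC hornerCM. Qed.

Lemma symbol_op0 : symbol_op 0 = 0.
Proof. by rewrite /symbol_op rmorph0 horner0. Qed.

(** The summand of highest k dominates, since I raises degrees and the c_k(H) do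
    not. *)
Lemma size_shift_symbol C : C != 0 ->
  exists n0 k, forall n, (n0 <= n)%N -> size_shift n (n + k) (symbol_op C).
Proof.
elim/poly_ind: C => [|C c IHC]; first by rewrite eqxx.
have [->|C0 _] := eqVneq C 0.
  rewrite mul0r add0r polyC_eq0 symbol_opC => /size_shift_euler [n0 cn0].
  by exists n0, 0%N => n; rewrite addn0; apply: cn0.
have [n0 [k Cn0]] := IHC C0; exists n0, k.+1 => n n0n.
rewrite symbol_opMXaddC; apply: size_shiftD.
  have In : size_shift n n.+1 I.
    by have := size_shift_add n (size_shift_I charK0).
  have Cn : size_shift n.+1 (n.+1 + k) (symbol_op C) by apply: Cn0; apply: leqW.
  by have := size_shiftM In Cn; rewrite addSnnS.
by right=> p; rewrite size_euler_le; split=> //; lia.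
Qed.

Lemma mulI_euler c : I * horner_alg H c = horner_alg H (c \Po ('X - 1%:P)) * I.
Proof.
apply: endoP => p; apply/polyP => i.
rewrite !endo_mulE coef_eulerE !coef_integral.
case: i => [|i]; first by rewrite mulr0.
by rewrite coef_eulerE horner_comp hornerXsubC -natr1 addrK mulrA.
Qed.

Lemma euler_mulI c : horner_alg H c * I = I * horner_alg H (c \Po ('X + 1%:P)).
Proof.
apply: endoP => p; apply/polyP => i.
rewrite !endo_mulE coef_eulerE !coef_integral.
case: i => [|i]; first by rewrite mulr0.
by rewrite coef_eulerE horner_comp hornerD hornerX hornerC natr1 mulrA.
Qed.

(** These operators form the subalgebra generated by H and I, by the commutation
    rules above. *)
Definition raising : set (endo K) := [set b | exists C, b = symbol_op C].

Lemma raising_euler c : raising (horner_alg H c).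
Proof. by exists c%:P; rewrite symbol_opC. Qed.

Lemma raising_add a b : raising a -> raising b -> raising (a + b).
Proof. by move=> [C1 ->] [C2 ->]; exists (C1 + C2); rewrite symbol_opD. Qed.

Lemma raising_eulerM c b : raising b -> raising (horner_alg H c * b).
Proof. by move=> [C ->]; exists (c%:P * C); rewrite symbol_opCM. Qed.

Lemma raising_mulI b n : raising b -> raising (b * I ^+ n).
Proof.
move=> Bb; elim: n => [|n [C Cn]]; first by rewrite mulr1.
exists (C * 'X + 0%:P); rewrite symbol_opMXaddC exprSr mulrA Cn.
by rewrite rmorph0 addr0.
Qed.

Lemma raising_Imul b : raising b -> raising (I * b).
Proof.
move=> [C ->]; elim/poly_ind: C => [|C c IHC].
  by exists 0; rewrite symbol_op0 mulr0.
rewrite symbol_opMXaddC mulrDr mulrA mulI_euler; apply: raising_add.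
  exact: (raising_mulI 1).
exact/(raising_mulI 1)/raising_euler.
Qed.

Lemma raising_mul a b : raising a -> raising b -> raising (a * b).
Proof.
move=> [C ->]; elim/poly_ind: C b => [|C c IHC] b Bb.
  by exists 0; rewrite symbol_op0 mul0r.
rewrite symbol_opMXaddC mulrDl -mulrA; apply: raising_add.
  exact/IHC/raising_Imul.
exact: raising_eulerM.
Qed.

Lemma raising_pushI n b : raising b ->
  exists2 b', raising b' & b * I ^+ n = I ^+ n * b'.
Proof.
elim: n b => [|n IHn] b Bb; first by exists b; rewrite ?mulr1 ?mul1r.
suff [b1 Bb1 bI] : exists2 b', raising b' & b * I = I * b'.
  have [b2 Bb2 b1I] := IHn b1 Bb1.
  by exists b2; rewrite // !exprS mulrA bI -mulrA b1I mulrA.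
case: Bb => [C ->]; elim/poly_ind: C => [|C c [b' Bb' CI]].
  by exists 0; [exists 0|]; rewrite symbol_op0 ?mul0r ?mulr0.
exists (b' * I + horner_alg H (c \Po ('X + 1%:P))).
  by apply: raising_add; [apply: (raising_mulI 1)|apply: raising_euler].
by rewrite symbol_opMXaddC mulrDl CI euler_mulI mulrDr mulrA.
Qed.

(** D can be cleared from the right: D I = 1, and raising operators move past
    powers of I, so the denominators I^N of a product can be collected. *)
Lemma I1_raising a : I1 K a -> exists N, raising (a * I ^+ N).
Proof.
pose S : {pred endo K} := [pred a | `[< exists N, raising (a * I ^+ N) >]].
have raise b N L : (N <= L)%N -> raising (b * I ^+ N) -> raising (b * I ^+ L).
  by move=> /subnKC <-; rewrite exprD mulrA; apply: raising_mulI.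
have B1 : raising 1 by have := raising_euler 1; rewrite rmorph1.
move=> aI1; suff : a \in S by move=> /asboolP.
apply: aI1.
- split.
  + by apply/asboolP; exists 0%N; rewrite mulr1.
  + move=> k u v /asboolP [N uN] /asboolP [L vL]; apply/asboolP.
    exists (maxn N L); rewrite mulrDl; apply: raising_add; last first.
      by apply: raise vL; apply: leq_maxr.
    have := raising_eulerM k%:P (raise _ _ _ (leq_maxl N L) uN).
    by rewrite horner_algC -scalerAl mul1r scalerAl.
  + move=> u v /asboolP [N uN] /asboolP [L vL]; apply/asboolP.
    have [b Bb vb] := raising_pushI N vL; exists (L + N)%N.
    rewrite exprD mulrA -(mulrA u) -mulrA vb mulrA; exact: raising_mul.
- apply/asboolP; exists 0%N; rewrite mulr1.
  have -> : X_ = horner_alg H 'X * I :> endo K.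
    by rewrite horner_algX -mulrA D_mulI // mulr1.
  exact/(raising_mulI 1)/raising_euler.
- by apply/asboolP; exists 1%N; rewrite D_mulI.
- by apply/asboolP; exists 0%N; rewrite mulr1 -[I_]mulr1; apply: raising_Imul.
Qed.

(** From a I^N = b the operator is recovered modulo F as b D^N. *)
Lemma I1_size_shift a : I1 K a -> ~ F K a -> exists N M, size_shift N M a.
Proof.
move=> /I1_raising [N [C aC]] aF.
have C0 : C != 0.
  apply/eqP => C0; apply/aF/F_annihil => //; exists N.
  by rewrite aC C0 symbol_op0.
have [n0 [k Cn]] := size_shift_symbol C0.
have sCD : size_shift (N + n0) (n0 + k) (symbol_op C * D ^+ N).
  apply: size_shiftM (Cn _ (leqnn n0)).
  exact: (size_shift_add n0 (size_shift_Dn charK0 N)).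
have Fa : F K (a * (1 - I ^+ N * D ^+ N)).
  apply/F_annihil => //; exists N.
  by rewrite -mulrA mulrBl mul1r -mulrA Dn_mulIn // mulr1 subrr mulr0.
have [L aL] := size_shift_F charK0 sCD Fa.
exists (N + n0 + L)%N, (n0 + k + L)%N; have := aL L (leqnn L).
by rewrite mulrBr mulr1 mulrA aC addrC subrK.
Qed.

End Fredholm.

(** * The dimension of a quotient *)

Section QuotientDim.
Variables (K : fieldType) (E : lmodType K) (V W : set E).
Hypotheses (W0 : W 0) (WD : forall (k : K) u v, W u -> W v -> W (k *: u + v)).

Lemma closed_lincomb n (c : 'I_n -> K) (w : 'I_n -> E) :
  (forall i, W (w i)) -> W (\sum_i c i *: w i).
Proof.
move=> Ww; apply: big_ind => // [u v Wu Wv|i _].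
  by rewrite -[u]scale1r; apply: WD.
by rewrite -[_ *: _]addr0; apply: WD.
Qed.

(** Expressing b in d and d back in b modulo W gives matrices whose product is
    the identity, by independence of b modulo W. *)
Lemma quotient_basis_leq m n (b : 'I_m -> E) (d : 'I_n -> E) :
  quotient_basis V W b -> quotient_basis V W d -> (m <= n)%N.
Proof.
move=> [bV bgen bfree] [dV dgen dfree].
have /choice [c cP] i := dgen _ (bV i).
have /choice [c' c'P] i := bgen _ (dV i).
apply: (@mulmx1_min _ _ _ (\matrix_(i, j) c i j) (\matrix_(i, j) c' i j)).
apply/matrixP => i k; rewrite !mxE; apply/eqP; rewrite -subr_eq0; apply/eqP.
under eq_bigr do rewrite !mxE.
apply: (bfree (fun k => \sum_j c i j * c' j k - (i == k)%:R)).
have delta_sum : \sum_k (i == k)%:R *: b k = b i.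
  rewrite (bigD1 i) //= eqxx scale1r big1 ?addr0 // => j /negPf.
  by rewrite eq_sym => ->; rewrite scale0r.
have comp_sum : \sum_k (\sum_j c i j * c' j k) *: b k =
    \sum_j c i j *: \sum_k c' j k *: b k.
  under [RHS]eq_bigr do rewrite scaler_sumr.
  rewrite exchange_big /=; apply: eq_bigr => j _.
  by rewrite scaler_suml; apply: eq_bigr => l _; rewrite scalerA.
have -> : \sum_k (\sum_j c i j * c' j k - (i == k)%:R) *: b k =
    - 1 *: (b i - \sum_j c i j *: d j) +
    (- 1 *: (\sum_j c i j *: (d j - \sum_k c' j k *: b k)) + 0).
  under eq_bigr do rewrite scalerBl.
  under [X in _ = _ + (_ *: X + _)]eq_bigr do rewrite scalerBr.
  rewrite !sumrB delta_sum comp_sum addr0 !scaleN1r !opprB [RHS]addrC.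
  by rewrite addrA subrK.
by do 2![apply: WD => //]; apply: closed_lincomb.
Qed.

Lemma quotient_dimE n (b : 'I_n -> E) :
  quotient_basis V W b -> quotient_dim V W = n.
Proof.
move=> bP; rewrite /quotient_dim.
case: xgetP => [m _ [d dP]|/(_ n)[]]; last by exists b.
apply/eqP; rewrite eqn_leq.
by rewrite (quotient_basis_leq dP bP) (quotient_basis_leq bP dP).
Qed.

End QuotientDim.

(** * Kernel and cokernel as those of a matrix *)

Section ShiftMatrix.
Variables (K : fieldType).
Implicit Types (a b : endo K) (p q : {poly K}).

Definition shift_mx N M a : 'M[K]_(N, M) :=
  lin1_mx (poly_rV \o (a : {linear _ -> _}) \o rVpoly).

Lemma size_rVpoly d (v : 'rV[K]_d) : (size (rVpoly v) <= d)%N.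
Proof. exact: size_poly. Qed.

Lemma rVpoly_shift N M a (v : 'rV_N) :
  size_shift N M a -> rVpoly (v *m shift_mx N M a) = a (rVpoly v).
Proof.
move=> sa; rewrite mul_rV_lin1 /= poly_rV_K //.
exact/(size_shift_le sa)/size_rVpoly.
Qed.

Lemma shift_mxM N M P a b : size_shift N M a ->
  shift_mx N P (b * a) = shift_mx N M a *m shift_mx M P b.
Proof.
move=> sa; apply/row_matrixP => i; rewrite !rowE mulmxA !mul_rV_lin1 /=.
by rewrite poly_rV_K //; apply/(size_shift_le sa)/size_rVpoly.
Qed.

Lemma kernelE N M a p : size_shift N M a -> kernel a p <->
  (size p <= N)%N /\ (poly_rV p <= kermx (shift_mx N M a))%MS.
Proof.
move=> sa; split=> [ap0|[pN /sub_kermxP pA]].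
  have pN : (size p <= N)%N.
    by apply: (size_shift_mono sa); rewrite ap0 size_poly0.
  split=> //; apply/sub_kermxP; apply: (can_inj (@rVpolyK _ _)).
  by rewrite rVpoly_shift // poly_rV_K // ap0 linear0.
by rewrite /kernel /= -(poly_rV_K pN) -(rVpoly_shift _ sa) pA linear0.
Qed.

Lemma rangeE N M a q : size_shift N M a -> (size q <= M)%N ->
  range a q <-> (poly_rV q <= shift_mx N M a)%MS.
Proof.
move=> sa qM; split=> [[p _ apq]|/submxP [u uq]].
  have pN : (size p <= N)%N by apply: (size_shift_mono sa); rewrite apq.
  apply/submxP; exists (poly_rV p); apply: (can_inj (@rVpolyK _ _)).
  by rewrite rVpoly_shift // !poly_rV_K.
by exists (rVpoly u); rewrite // -(rVpoly_shift _ sa) -uq poly_rV_K.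
Qed.

(** Large degrees are all attained on the range, so leading terms can be
    cancelled one after another. *)
Lemma size_mod_range N M a q : size_shift N M a ->
  exists p, (size (q - a p)%R <= M)%N.
Proof.
move=> sa; have [k] := ubnP (size q); elim: k q => // k IHk q qk.
case: (leqP (size q) M) => [qM|qM]; first by exists 0; rewrite linear0 subr0.
(* The degree of u is chosen so that a u has the degree of q. *)
pose u : {poly K} := 'X^((size q - M + N).-1).
have su : size u = (size q - M + N)%N by rewrite size_polyXn; lia.
have sau : size (a u) = size q.
  by have := size_shift_gt sa (_ : (N < size u)%N); rewrite su; lia.
have q0 : lead_coef q != 0 by rewrite lead_coef_eq0 -size_poly_gt0; lia.
have au0 : lead_coef (a u) != 0.
  by rewrite lead_coef_eq0 -size_poly_gt0 sau; lia.
pose k0 := lead_coef q / lead_coef (a u).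
have [|p pM] := IHk (q - k0 *: a u).
  suff : (size (q - k0 *: a u)%R < size q)%N by lia.
  rewrite -(@prednK (size q)) ?ltnS; last by lia.
  apply/leq_sizeP => j; rewrite leq_eqVlt => /orP [/eqP <-|jq].
    have lead_au : (a u)`_(size q).-1 = lead_coef (a u).
      by rewrite lead_coefE sau.
    by rewrite coefB coefZ lead_au -lead_coefE divfK ?subrr.
  rewrite coefB coefZ !nth_default ?mulr0 ?subrr // ?sau;
    by rewrite prednK ?(leq_ltn_trans _ qM) in jq.
by exists (k0 *: u + p); rewrite linearD linearZZ opprD addrA.
Qed.

Lemma sum_rVpoly_row r n (C : 'M[K]_(r, n)) (c : 'I_r -> K) :
  \sum_i c i *: rVpoly (row i C) = rVpoly ((\row_i c i) *m C).
Proof.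
rewrite mulmx_sum_row linear_sum; apply: eq_bigr => i _.
by rewrite linearZZ mxE.
Qed.

Lemma dim_kerE N M a : size_shift N M a ->
  dim_ker a = (N - \rank (shift_mx N M a))%N.
Proof.
move=> sa; rewrite -mxrank_ker; set R := kermx _.
pose b (i : 'I_(\rank R)) : {poly K} := rVpoly (row i (row_base R)).
apply: (@quotient_dimE _ _ _ _ _ _ _ b) => //.
  by move=> k u v -> ->; rewrite scaler0 addr0.
split=> [i|p /(kernelE _ sa) [pN]|c].
- apply/(kernelE _ sa); rewrite rVpolyK size_rVpoly; split=> //.
  by rewrite (submx_trans (row_sub _ _)) // eq_row_base.
- rewrite -/R => pR.
  have /submxP [c cE] : (poly_rV p <= row_base R)%MS by rewrite eq_row_base.
  exists (c 0).
  have row_c : \row_i c 0 i = c by apply/rowP => i; rewrite mxE.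
  rewrite sum_rVpoly_row row_c.
  by rewrite -cE poly_rV_K // subrr.
rewrite sum_rVpoly_row => /(congr1 (@poly_rV _ N)).
rewrite rVpolyK linear0 => /eqP.
rewrite mulmx_free_eq0 ?row_base_free // => /eqP c0 i.
by have /rowP/(_ i) := c0; rewrite !mxE.
Qed.

Lemma dim_cokerE N M a : size_shift N M a ->
  dim_coker a = (M - \rank (shift_mx N M a))%N.
Proof.
move=> sa; rewrite -mxrank_compl; set A := shift_mx _ _ _; set R := (A^C)%MS.
pose b (i : 'I_(\rank R)) : {poly K} := rVpoly (row i (row_base R)).
apply: (@quotient_dimE _ _ _ _ _ _ _ b).
- by exists 0; rewrite ?linear0.
- move=> k _ _ [u _ <-] [v _ <-]; exists (k *: u + v) => //.
  by rewrite linearD linearZZ.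
split=> [i //|q _|c].
- have [p qM] := size_mod_range q sa.
  have /sub_addsmxP [[u z] /= E] : (poly_rV (q - a p) <= A + R)%MS.
    by apply: submx_full; apply: addsmx_compl_full.
  have : (z *m R <= row_base R)%MS by rewrite eq_row_base submxMl.
  case/submxP => c cE; exists (c 0).
  have row_c : \row_i c 0 i = c by apply/rowP => i; rewrite mxE.
  rewrite sum_rVpoly_row row_c.
  exists (p + rVpoly u) => //; rewrite linearD -(rVpoly_shift _ sa) -cE.
  have := congr1 (@rVpoly _ _) E; rewrite poly_rV_K // linearD => /eqP.
  by rewrite subr_eq addrAC -subr_eq => /eqP ->; rewrite addrC.
rewrite sum_rVpoly_row => /(rangeE sa).
rewrite rVpolyK size_rVpoly => /(_ isT) cA.
have : ((\row_i c i) *m row_base R <= A :&: R)%MS.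
  by rewrite sub_capmx cA -(eq_row_base R) submxMl.
rewrite capmx_compl submx0 mulmx_free_eq0 ?row_base_free // => /eqP c0 i.
by have /rowP/(_ i) := c0; rewrite !mxE.
Qed.

End ShiftMatrix.

(** * Units of 1 + F from invertible matrices *)

(** The matrix G on the coefficients of degree < M, and the identity on the
    others. *)
Definition extend_mx (K : fieldType) M (G : 'M[K]_M) (p : {poly K}) :
    {poly K} :=
  p + rVpoly (poly_rV p *m (G - 1%:M)).

Fact extend_mx_linear (K : fieldType) M (G : 'M[K]_M) : linear (extend_mx G).
Proof.
move=> k p q; rewrite /extend_mx scalerDr addrACA; congr (_ + _).
by rewrite !linearP mulmxDl linearD -scalemxAl linearZ.
Qed.
HB.instance Definition _ (K : fieldType) M (G : 'M[K]_M) :=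
  GRing.isLinear.Build K {poly K} {poly K} *:%R (extend_mx G)
    (extend_mx_linear G).

Section Conjugation.
Variables (K : fieldType) (charK0 : [pchar K] =i pred0).
Local Notation I := (I_ : endo K).
Local Notation D := (D_ : endo K).
Implicit Types (a b f g s t : endo K) (p q : {poly K}).

Definition extension M (G : 'M[K]_M) : endo K := extend_mx G.

(** The order is reversed because matrices act on row vectors. *)
Lemma extensionM M (G1 G2 : 'M[K]_M) :
  extension G2 * extension G1 = extension (G1 *m G2).
Proof.
apply: endoP => p; rewrite endo_mulE /extension /= /extend_mx.
have -> : poly_rV (p + rVpoly (poly_rV p *m (G1 - 1%:M))) = poly_rV p *m G1.
  by rewrite linearD /= rVpolyK mulmxBr mulmx1 addrC subrK.
rewrite -addrA -linearD -mulmxA -mulmxDr; congr (_ + rVpoly (_ *m _)).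
by rewrite mulmxBr mulmx1 addrC addrA subrK.
Qed.

Lemma extension1 M : extension (1%:M : 'M_M) = 1.
Proof.
apply: endoP => p.
by rewrite /extension /= /extend_mx subrr mulmx0 linear0 addr0.
Qed.

Lemma extension_small M (G : 'M_M) p :
  (size p <= M)%N -> extension G p = rVpoly (poly_rV p *m G).
Proof.
move=> pM; rewrite /extension /= /extend_mx mulmxBr mulmx1 linearB /=.
by rewrite poly_rV_K // addrC subrK.
Qed.

Lemma coef_In_small n p i : (i < n)%N -> ((I ^+ n) p)`_i = 0.
Proof.
elim: n p i => // n IHn p [|i] ni; rewrite exprS endo_mulE coef_integral //.
by rewrite IHn ?mul0r.
Qed.

Lemma extension_oneF M (G : 'M_M) : oneF K (extension G).
Proof.
exists (extension G - 1); last by rewrite addrC subrK.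
apply/F_annihil => //; exists M; apply: endoP => p.
rewrite endo_mulE endo_subE endo1E /extension /= /extend_mx.
have -> : poly_rV ((I ^+ M) p) = 0 :> 'rV_M.
  by apply/rowP => i; rewrite !mxE coef_In_small.
by rewrite mul0mx linear0 addr0 subrr.
Qed.

Lemma extension_units M (G : 'M_M) : G \in unitmx -> oneF_units K (extension G).
Proof.
move=> uG; split; first exact: extension_oneF.
exists (extension (invmx G)); rewrite !extensionM.
rewrite mulmxV // mulVmx // extension1.
by split=> //; apply: extension_oneF.
Qed.

Lemma units_inv s : oneF_units K s ->
  [/\ oneF K s^-1, s * s^-1 = 1 & s^-1 * s = 1].
Proof.
move=> [_ [t [tF st ts]]].
have us : s \is a GRing.unit by apply/unitrP; exists t.
have -> : s^-1 = t by rewrite -[s^-1]mulr1 -st mulrA mulVr // mul1r.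
by [].
Qed.

Lemma units_invK s p : oneF_units K s -> s (s^-1 p) = p.
Proof. by move=> /units_inv [_ ss' _]; rewrite -endo_mulE ss'. Qed.

Lemma units_Kinv s p : oneF_units K s -> s^-1 (s p) = p.
Proof. by move=> /units_inv [_ _ ss']; rewrite -endo_mulE ss'. Qed.

(** Modulo F both s and s^-1 are 1; the hypothesis is that F b is contained in F. *)
Lemma conj_mod_F s b : oneF_units K s -> (forall f, F K f -> F K (f * b)) ->
  F K (s * b * s^-1 - b).
Proof.
move=> us bF; have [[f Ff sE] _] := us.
have [[g Fg gE] _ _] := units_inv us.
have -> : s * b * s^-1 - b = f * b + s * b * g.
  by rewrite gE mulrDr mulr1 {1}sE mulrDl mul1r [b + _]addrC addrAC addrK.
by apply: F_add => //; [apply: bF | apply: F_mull].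
Qed.

Lemma conjD s n : oneF_units K s -> F K (s * D ^+ n * s^-1 - D ^+ n).
Proof. by move=> us; apply: conj_mod_F us _ => f; apply: F_mulD. Qed.

Lemma conjI s n : oneF_units K s -> F K (s * I ^+ n * s^-1 - I ^+ n).
Proof. by move=> us; apply: conj_mod_F us _ => f; apply: F_mulI. Qed.

(** The unit extends the invertible factor in the Gaussian elimination of B, whose
    first rank B rows span the row space of B. *)
Lemma unit_spanning M (B : 'M[K]_M) : exists2 s, oneF_units K s &
  forall z : 'rV_M, (z <= B)%MS ->
    exists2 q : {poly K}, (size q <= \rank B)%N & s q = rVpoly z.
Proof.
exists (extension (row_ebase B)); first exact/extension_units/row_ebase_unit.
move=> _ /submxP [y ->]; pose w := y *m col_ebase B *m pid_mx (\rank B) : 'rV_M.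
exists (rVpoly w).
  apply/leq_sizeP => j rj; rewrite coef_rVpoly; case: insubP => // i _ ij.
  rewrite mxE big1 // => l _; rewrite [pid_mx _ _ _]mxE ltnNge.
  by case: eqP => [->|_]; rewrite ?ij ?rj mulr0.
by rewrite extension_small ?size_rVpoly // rVpolyK /w -!(mulmxA y) mulmx_ebase.
Qed.

(** * Surjective and injective composites *)

Lemma surjectionP b : surjection b <-> forall q, exists p, b p = q.
Proof.
split=> [sb q|sb q _]; last by have [p pq] := sb q; exists p.
by have [p _ pq] := sb q Logic.I; exists p.
Qed.

Lemma endo_injectiveP b : injective b <-> forall p, b p = 0 -> p = 0.
Proof.
split=> [ib p bp|ib p q]; first by apply: ib; rewrite bp linear0.
move/eqP; rewrite -subr_eq0 -linearB => /eqP /ib /eqP.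
by rewrite subr_eq0 => /eqP.
Qed.

Lemma surjection_rank N M b : size_shift N M b -> surjection b ->
  \rank (shift_mx N M b) = M.
Proof.
move=> sb /surjectionP surj; apply/eqP; rewrite -[_ == _]/(row_full _) -sub1mx.
apply/row_subP => i; rewrite -[row i _]rVpolyK; apply/(rangeE sb).
  exact: size_rVpoly.
by have [p pq] := surj (rVpoly (row i 1%:M)); exists p.
Qed.

Lemma injective_rank N M b : size_shift N M b -> injective b ->
  \rank (shift_mx N M b) = N.
Proof.
move=> sb /endo_injectiveP inj; apply/eqP; rewrite -[_ == _]/(row_free _).
rewrite -kermx_eq0 -submx0; apply/row_subP => i; rewrite submx0; apply/eqP.
apply: (can_inj (@rVpolyK _ _)); rewrite linear0; apply: inj.
apply/(kernelE _ sb); rewrite size_rVpoly rVpolyK; split=> //; exact: row_sub.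
Qed.

(** The polynomials of size at most n are the kernel of D^n, so a surjection
    results once s maps them onto a complement of the range of a. *)
Lemma surjection_conj a N M : size_shift N M a ->
  exists2 s, oneF_units K s &
    surjection (s * D ^+ dim_coker a * s^-1 * a).
Proof.
move=> sa; set A := shift_mx N M a; rewrite (dim_cokerE sa) -/A.
have [s us sP] := unit_spanning (A^C)%MS; exists s => //.
rewrite mxrank_compl in sP; set n := (M - _)%N in sP *.
(* A preimage of y under s D^n s^-1 is v; its component s q in the complement of
   the range is killed by D^n s^-1. *)
apply/surjectionP => y; pose v := s ((I ^+ n) (s^-1 y)).
have [p0 vM] := size_mod_range v sa.
have /sub_addsmxP [[u z] /= vE] : (poly_rV (v - a p0)%R <= A + A^C)%MS.
  by apply: submx_full; apply: addsmx_compl_full.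
have [q qn sq] := sP _ (submxMl z _).
exists (p0 + rVpoly u).
have av : a (p0 + rVpoly u) = v - s q.
  have := congr1 (@rVpoly _ _) vE; rewrite poly_rV_K // linearD /= -sq => /eqP.
  rewrite (rVpoly_shift _ sa) subr_eq addrAC -subr_eq => /eqP ->.
  by rewrite linearD addrC.
rewrite ?endo_mulE av linearB /v !units_Kinv //.
rewrite linearB (Dn_small charK0 qn) subr0 -(endo_mulE (D ^+ n)) Dn_mulIn //.
exact: units_invK.
Qed.

(** The kernels are nested, and have the same dimension because a and the
    composite have matrices of the same rank. *)
Lemma surjection_kernel a N M f : size_shift N M a -> F K f ->
  surjection ((D ^+ dim_coker a + f) * a) ->
  kernel ((D ^+ dim_coker a + f) * a) = kernel a.
Proof.
set n := dim_coker a; move=> sa Ff surj.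
have nM : (n <= M)%N by rewrite /n (dim_cokerE sa) leq_subr.
have [L sb] := size_shift_F charK0 (size_shift_Dn charK0 n) Ff.
(* The bounds are raised so that those of the two factors match. *)
have {}sb : size_shift (M + L) (M + L - n) (D ^+ n + f).
  have := sb (M + L - n)%N; rewrite add0n subnKC.
    by apply; lia.
  exact: leq_trans (leq_addr _ _).
have {}sa := size_shift_add L sa.
have sba := size_shiftM sa sb.
have rkA : \rank (shift_mx (N + L) (M + L) a) = (M + L - n)%N.
  by rewrite /n (dim_cokerE sa) subKn // rank_leq_col.
have rkBA := surjection_rank sba surj.
rewrite (shift_mxM _ _ sa) in rkBA.
have := kernelE _ sba; rewrite (shift_mxM _ _ sa) => kerE.
set A := shift_mx _ _ a in rkA rkBA kerE; set B := shift_mx _ _ _ in rkBA kerE.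
have kAB : (kermx A <= kermx (A *m B))%MS.
  by apply/sub_kermxP; rewrite mulmxA mulmx_ker mul0mx.
apply/seteqP; split=> p; last first.
  by rewrite /kernel /= => ->; rewrite !linear0 addr0.
move=> /kerE [pN pk]; apply/(kernelE _ sa); split=> //.
apply: submx_trans pk _; rewrite -(geq_leqif (mxrank_leqif_sup kAB)).
by rewrite !mxrank_ker rkBA rkA.
Qed.

(** The range of I^n is a complement to the polynomials of size at most n, and s
    is chosen to map the latter onto the kernel of a. *)
Lemma injective_conj a N M : size_shift N M a ->
  exists2 s, oneF_units K s & injective (a * s * I ^+ dim_ker a * s^-1).
Proof.
move=> sa; set A := shift_mx N M a; rewrite (dim_kerE sa) -/A.
have [s us sP] := unit_spanning (kermx A); exists s => //.
rewrite mxrank_ker in sP; set n := (N - _)%N in sP *.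
apply/endo_injectiveP => p; rewrite !endo_mulE => /(kernelE _ sa) [pN pk].
have [q qn sq] := sP _ pk; rewrite poly_rV_K // in sq.
have Iq : (I ^+ n) (s^-1 p) = q.
  by rewrite -(units_Kinv ((I ^+ n) _) us) -sq units_Kinv.
have s'p : s^-1 p = 0.
  rewrite -[s^-1 p]endo1E -(Dn_mulIn charK0 n) endo_mulE Iq.
  exact: Dn_small.
by rewrite -(units_invK p us) s'p linear0.
Qed.

(** The ranges are nested, and their matrices have the same rank. *)
Lemma injective_range a N M g : size_shift N M a -> F K g ->
  injective (a * (I ^+ dim_ker a + g)) ->
  range (a * (I ^+ dim_ker a + g)) = range a.
Proof.
set n := dim_ker a; move=> sa Fg inj.
have nN : (n <= N)%N by rewrite /n (dim_kerE sa) leq_subr.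
have [L sb] := size_shift_F charK0 (size_shift_In charK0 n) Fg.
have {}sb : size_shift (N + L - n) (N + L) (I ^+ n + g).
  have := sb (N + L - n)%N; rewrite add0n subnKC.
    by apply; lia.
  exact: leq_trans (leq_addr _ _).
have {}sa := size_shift_add L sa.
have sab := size_shiftM sb sa.
have rkA : \rank (shift_mx (N + L) (M + L) a) = (N + L - n)%N.
  by rewrite /n (dim_kerE sa) subKn // rank_leq_row.
have rkAB := injective_rank sab inj.
rewrite (shift_mxM _ _ sb) in rkAB.
have := rangeE sab; rewrite (shift_mxM _ _ sb) => ranE.
set A := shift_mx _ _ a in rkA rkAB ranE; set B := shift_mx _ _ _ in rkAB ranE.
have AAB : (A <= B *m A)%MS.
  by rewrite -(geq_leqif (mxrank_leqif_sup (submxMl B A))) rkA rkAB.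
apply/seteqP; split=> q; first by move=> [p _ <-]; exists ((I ^+ n + g) p).
move=> [p _ apq]; have [p' qM] := size_mod_range q sab.
have [p1 _ p1E] : range (a * (I ^+ n + g)) (q - (a * (I ^+ n + g)) p').
  apply/ranE => //; apply: submx_trans AAB; apply/(rangeE sa) => //.
  by exists (p - (I ^+ n + g) p'); rewrite // linearB apq.
by exists (p1 + p'); rewrite // linearD p1E subrK.
Qed.

Lemma bijective_conj a b c : surjection (b * a) -> kernel (b * a) = kernel a ->
  injective (a * c) -> range (a * c) = range a -> bijective (b * a * c).
Proof.
move=> /surjectionP surj kerE /endo_injectiveP inj ranE.
have binj : injective (b * a * c).
  apply/endo_injectiveP => p; rewrite !endo_mulE => bacp.
  by apply: inj; change (kernel a (c p)); rewrite -kerE.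
have /choice [h hK] q : exists p, (b * a * c) p = q.
  have [p pq] := surj q; have : range a (a p) by exists p.
  by rewrite -ranE => -[p' _ p'E]; exists p'; rewrite -mulrA endo_mulE p'E.
by exists h => // p; apply: binj; rewrite hK.
Qed.

End Conjugation.

Theorem proposition6p11 (K : fieldType) (charK0 : [pchar K] =i pred0) :
  [/\ forall a : endo K, I1 K a -> ~ F K a ->
      let n := dim_coker a in
      [/\ exists2 f, F K f & surjection ((D_ ^+ n + f) * a),
          forall f, F K f -> surjection ((D_ ^+ n + f) * a) ->
            kernel ((D_ ^+ n + f) * a) = kernel a,
          exists2 s, oneF_units K s & surjection (s * D_ ^+ n * s^-1 * a)
        & forall s, oneF_units K s -> surjection (s * D_ ^+ n * s^-1 * a) ->
            kernel (s * D_ ^+ n * s^-1 * a) = kernel a],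
      forall a : endo K, I1 K a -> ~ F K a ->
      let n := dim_ker a in
      [/\ exists2 g, F K g & injective (a * (I_ ^+ n + g)),
          forall g, F K g -> injective (a * (I_ ^+ n + g)) ->
            range (a * (I_ ^+ n + g)) = range a,
          exists2 s, oneF_units K s & injective (a * s * I_ ^+ n * s^-1)
        & forall s, oneF_units K s -> injective (a * s * I_ ^+ n * s^-1) ->
            range (a * s * I_ ^+ n * s^-1) = range a]
    & forall a : endo K, I1 K a -> ~ F K a ->
      let m := dim_ker a in
      let n := dim_coker a in
      (exists f g, [/\ F K f, F K g &
         bijective ((D_ ^+ n + f) * a * (I_ ^+ m + g))]) /\
      (exists s t, [/\ oneF_units K s, oneF_units K t &
         bijective (s * D_ ^+ n * s^-1 * a * t * I_ ^+ m * t^-1)])].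
Proof.
have conjDE (s : endo K) n : s * D_ ^+ n * s^-1 =
    D_ ^+ n + (s * D_ ^+ n * s^-1 - D_ ^+ n).
  by rewrite addrC subrK.
have conjIE (a s : endo K) n : a * s * I_ ^+ n * s^-1 =
    a * (I_ ^+ n + (s * I_ ^+ n * s^-1 - I_ ^+ n)).
  by rewrite addrC subrK !mulrA.
split=> a aI aF; have [N [M sa]] := I1_size_shift charK0 aI aF; cbv zeta.
- have [s us surj] := surjection_conj charK0 sa.
  split; [|by move=> f; apply: surjection_kernel sa|by exists s|].
    exists (s * D_ ^+ dim_coker a * s^-1 - D_ ^+ dim_coker a).
      exact: conjD.
    by rewrite -conjDE.
  move=> t ut; rewrite conjDE; apply: surjection_kernel sa _ => //.
  exact: conjD.
- have [s us inj] := injective_conj charK0 sa.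
  split; [|by move=> g; apply: injective_range sa|by exists s|].
    exists (s * I_ ^+ dim_ker a * s^-1 - I_ ^+ dim_ker a).
      exact: conjI.
    by rewrite -conjIE.
  move=> t ut; rewrite conjIE; apply: injective_range sa _ => //.
  exact: conjI.
have [s us surj] := surjection_conj charK0 sa.
have [t ut inj] := injective_conj charK0 sa.
have Ff := conjD charK0 (dim_coker a) us.
have Fg := conjI charK0 (dim_ker a) ut.
rewrite conjDE in surj; rewrite conjIE in inj.
have kerE := surjection_kernel charK0 sa Ff surj.
have ranE := injective_range charK0 sa Fg inj.
have bij := bijective_conj surj kerE inj ranE.
split; first by do 2!eexists; split; [exact: Ff|exact: Fg|].
by exists s, t; split=> //; rewrite conjIE conjDE.
Qed.
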